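(* Let $Z=(z_n)_{n\ge1}$ be a sequence in $\mathbb{D}$ satisfying the Shapiro--Shields condition $$\sum_{n=1}^\infty\frac{1}{|\log(1-|z_n|)|}<\infty.$$ Then the set $$\mathcal{E}(Z)=\Big\{\zeta\in\mathbb{T}:\ \sum_{n=1}^\infty\frac{1-|z_n|^2}{|\zeta-z_n|^2}=\infty\Big\}$$ has logarithmic capacity zero.
   Context: $\mathbb{D}$ is the open unit disk and $\mathbb{T}$ the unit circle in $\mathbb{C}$. The energy of a Borel probability measure $\mu$ on $\mathbb{T}$ is $I(\mu)=\iint\log\frac{1}{|\zeta-\xi|}\,d\mu(\zeta)\,d\mu(\xi)\in[0,\infty]$. For a Borel set $F\subset\mathbb{T}$, let $\mathcal{P}(F)$ be the set of Borel probability measures supported on a compact subset of $F$; the logarithmic capacity of $F$ is $\mathrm{cap}(F)=1/\inf\{I(\mu):\mu\in\mathcal{P}(F)\}$ (with $1/\infty=0$, $1/0=\infty$, $\inf\emptyset=\infty$). A term $1/|\log(1-|z_n|)|$ with $z_n=0$ is interpreted as $+\infty$. *)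

(* Defs.v *)
From HB Require Import structures.
From mathcomp Require Import all_boot all_order all_algebra.
From mathcomp Require Import all_classical all_reals all_analysis.
From mathcomp.real_closed Require Export complex.

Set Implicit Arguments.
Unset Strict Implicit.
Unset Printing Implicit Defensive.

Import Order.TTheory GRing.Theory Num.Theory.
Import numFieldNormedType.Exports.

Local Open Scope classical_set_scope.
Local Open Scope ring_scope.

(* The norm of R[i] as a numFieldType is R[i]-valued. The copied structure is
   the metric topology of this norm, hence the usual topology of the plane. The
   real-valued modulus used below is ComplexField.Normc.normc, for which
   `|z| = (normc z)%:C. *)
HB.instance Definition _ (R : realType) :=
  NormedModule.copy R[i] ((R[i] : numFieldType)^o).

Notation cmod := ComplexField.Normc.normc.

(* R[i] with its Borel sigma-algebra; convertible to R[i]. *)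
Definition borelC (R : realType) := g_sigma_algebraType (@open R[i]).

Definition unit_disk (R : realType) : set R[i] := [set z | cmod z < 1].

Definition unit_circle (R : realType) : set R[i] := [set z | cmod z = 1].

(* log (1 / |x - y|), with value +oo on the diagonal since 0^-1 = +oo in \bar R
   and lne +oo = +oo. *)
Definition log_kernel (R : realType) (x y : R[i]) : \bar R :=
  lne ((cmod (x - y))%:E^-1)%E.

(* A Borel probability measure on the circle is represented by a Borel
   probability measure on R[i] of mass 1 on the circle. The kernel is at least
   - ln 2 on the circle, so that the iterated integral is the double one. *)
Definition log_energy (R : realType) (mu : probability (borelC R) R) : \bar R :=
  (\int[mu]_(x in @unit_circle R) \int[mu]_(y in @unit_circle R)
     log_kernel x y)%E.

(* mu K = 1 for a compact (hence closed) K says that mu is supported on K. *)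
Definition compactly_supported_in (R : realType) (F : set R[i]) :
    set (probability (borelC R) R) :=
  [set mu | exists K : set R[i], [/\ compact K, K `<=` F & mu K = 1%E]].

(* Meant for Borel subsets F of the unit circle. In \bar R, (+oo)^-1 = 0,
   0^-1 = +oo and ereal_inf set0 = +oo. *)
Definition log_capacity (R : realType) (F : set R[i]) : \bar R :=
  (ereal_inf [set log_energy mu | mu in compactly_supported_in F])^-1%E.

(* The inverse is taken in \bar R, so that a term with z n = 0 is +oo. *)
Definition shapiro_shields (R : realType) (z : nat -> R[i]) : Prop :=
  (\sum_(0 <= n <oo) (`|ln (1 - cmod (z n))|%R)%:E^-1 < +oo)%E.

Definition exceptional_set (R : realType) (z : nat -> R[i]) : set R[i] :=
  [set zeta | unit_circle zeta /\
    (\sum_(0 <= n <oo)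
       ((1 - cmod (z n) ^+ 2) / cmod (zeta - z n) ^+ 2)%R%:E = +oo)%E].

(* Main.v *)
Require Import Defs.
From mathcomp Require Import all_boot all_order all_algebra.
From mathcomp Require Import all_classical all_reals all_analysis.
From mathcomp Require Import measurable_realfun ring lra.

(** The series defining the exceptional set can diverge at zeta only if zeta
    lies in infinitely many of the discs B_n centred at z_n with radius
    r_n = (1 - |z_n|)^(1/4). Indeed, off B_n the n-th term is at most
    2 (1 - |z_n|)^(1/2), which is O(1 / |log (1 - |z_n|)|), the general term of
    a convergent series ([poisson_le], [exceptional_set_sub_limsup]).

    It remains to see that a measure mu of finite energy does not charge the
    limit superior of discs B_n such that 1 / log (1 / r_n) is summable
    ([finite_energy_limsup_negligible]). The bound
    mu (B_n)^2 log (1 / (2 r_n)) <= O(1) given by the energy alone is too weak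
    for Borel-Cantelli because of the square. But the potential U of mu is
    integrable, hence finite almost everywhere, and where U is at most m the
    bound becomes linear: a point x of B_n with U (x) <= m sees all of B_n
    within distance 2 r_n, so that mu (B_n) log (1 / r_n) <= m + log 2
    ([log_potential_ge_ball]). Thus the masses of B_n intersected with
    {U <= m} are summable, Borel-Cantelli applies to them for each m, and the
    sets {U <= m} exhaust the circle up to a null set.

    Hence a probability measure carried by a compact part of the exceptional
    set has infinite energy. *)

Set Implicit Arguments.
Unset Strict Implicit.
Unset Printing Implicit Defensive.

Import Order.TTheory GRing.Theory Num.Theory.
Import numFieldNormedType.Exports.

Local Open Scope classical_set_scope.
Local Open Scope ring_scope.

(** * Measurability in the plane *)

Lemma normReIm_le_cmod (R : realType) (z : R[i]) :
  `|complex.Re z| <= cmod z /\ `|complex.Im z| <= cmod z.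
Proof.
case: z => a b /=; rewrite -!sqrtr_sqr !ler_wsqrtr //.
  by rewrite lerDr sqr_ge0.
by rewrite lerDl sqr_ge0.
Qed.

(** The half-planes Re > a and Im > a are open because both coordinates are
    1-Lipschitz, and the rays ]a, +oo[ generate the Borel sets of the line. *)
Lemma measurable_lipschitzC (R : realType) (f : R[i] -> R) :
  (forall x y, `|f x - f y| <= cmod (x - y)) ->
  measurable_fun setT (f : borelC R -> R).
Proof.
move=> lipf; apply: (measurability _ (RGenOInfty.measurableE R)).
move=> _ [_ [a ->]] <-; rewrite setTI; apply: sub_sigma_algebra.
rewrite openE => x /=; rewrite in_itv/= andbT => ax; apply/nbhs_ballP.
exists (f x - a)%:C%C => [|y] /=; first by rewrite ltcR subr_gt0.
rewrite -ball_normE /= in_itv/= andbT => xy.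
have {}xy : cmod (x - y) < f x - a by rewrite -ltcR.
have := le_lt_trans (ler_norm _) (le_lt_trans (lipf x y) xy).
by rewrite ltrD2l ltrN2.
Qed.

(** The proof goes through coordinates, as they give joint measurability
    on a product sigma-algebra without comparing it with the Borel
    sigma-algebra of the product topology. *)
Lemma measurable_cmod_sub d (T : measurableType d) (R : realType)
    (f g : T -> borelC R) :
  measurable_fun setT f -> measurable_fun setT g ->
  measurable_fun setT (fun t => cmod ((f t : R[i]) - (g t : R[i]))).
Proof.
move=> mf mg.
have lipRe (x y : R[i]) : `|complex.Re x - complex.Re y| <= cmod (x - y).
  by rewrite -raddfB; case: (normReIm_le_cmod (x - y)).
have lipIm (x y : R[i]) : `|complex.Im x - complex.Im y| <= cmod (x - y).
  by rewrite -raddfB; case: (normReIm_le_cmod (x - y)).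
have cmodE (z : R[i]) :
  cmod z = Num.sqrt (complex.Re z ^+ 2 + complex.Im z ^+ 2) by case: z.
under [X in measurable_fun _ X]eq_fun do rewrite cmodE !raddfB /=.
apply: (measurableT_comp (f := @Num.sqrt R)).
  apply: continuous_measurable_fun; exact: sqrt_continuous.
by apply: measurable_funD; apply: measurable_funX; apply: measurable_funB;
  [apply: (measurableT_comp (measurable_lipschitzC lipRe))|
   apply: (measurableT_comp (measurable_lipschitzC lipRe))|
   apply: (measurableT_comp (measurable_lipschitzC lipIm))|
   apply: (measurableT_comp (measurable_lipschitzC lipIm))].
Qed.

Lemma log_kernelE (R : realType) (x y : R[i]) :
  log_kernel x y =
  if cmod (x - y) == 0 then +oo%E else (- ln (cmod (x - y)))%:E.
Proof.
have n0 : 0 <= cmod (x - y) by case: (x - y) => a b; exact: sqrtr_ge0.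
rewrite /log_kernel inver; case: ifPn => // xy0.
have c0 : 0 < cmod (x - y) by rewrite lt_neqAle eq_sym xy0.
by rewrite /lne leNgt invr_gt0 c0/= lnV.
Qed.

Lemma measurable_log_kernel (R : realType) :
  measurable_fun setT
    (fun p : borelC R * borelC R => log_kernel (p.1 : R[i]) (p.2 : R[i])).
Proof.
have mD := measurable_cmod_sub (@measurable_fst _ _ (borelC R) (borelC R))
  (@measurable_snd _ _ (borelC R) (borelC R)).
under [X in measurable_fun _ X]eq_fun do rewrite log_kernelE.
apply: measurable_fun_ifT => //.
  exact: (measurable_fun_eqr mD).
apply/measurable_EFinP; apply: measurableT_comp => //.
exact: (measurableT_comp (@measurable_ln R) mD).
Qed.

Lemma compact_borelC_measurable (R : realType) (K : set R[i]) :
  compact K -> measurable (K : set (borelC R)).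
Proof.
move=> cK; rewrite -(setCK K); apply: measurableC; apply: sub_sigma_algebra.
by apply: closed_openC; apply: compact_closed cK; exact: norm_hausdorff.
Qed.

(** * Integrals of functions bounded below *)

(** Monotonicity without integrability: it holds for the positive and the
    negative parts separately, and the extended difference of their integrals
    is monotone even when it is oo - oo. It is needed for potentials, which may
    be +oo. *)
Lemma le_integral_measurable d (T : measurableType d) (R : realType)
    (mu : {measure set T -> \bar R}) (D : set T) (f g : T -> \bar R) :
  measurable D -> measurable_fun D f -> measurable_fun D g ->
  (forall x, D x -> f x <= g x)%E ->
  (\int[mu]_(x in D) f x <= \int[mu]_(x in D) g x)%E.
Proof.
move=> mD mf mg fg; rewrite integralE [leRHS]integralE; apply: leeB.
- apply: ge0_le_integral => //; try exact: measurable_funepos.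
  by move=> x Dx; apply: (@funepos_le _ _ D); rewrite ?inE// => y /set_mem/fg.
- apply: ge0_le_integral => //; try exact: measurable_funeneg.
  by move=> x Dx; apply: (@funeneg_le _ _ D); rewrite ?inE// => y /set_mem/fg.
Qed.

(** The negative part is dominated by a constant, which a finite measure
    integrates; so the positive part carries the whole integral. *)
Lemma integrable_bounded_below d (T : measurableType d) (R : realType)
    (mu : {finite_measure set T -> \bar R}) (D : set T) (f : T -> \bar R)
    (c : R) :
  measurable D -> measurable_fun D f -> (forall x, D x -> c%:E <= f x)%E ->
  (\int[mu]_(x in D) f x < +oo)%E -> mu.-integrable D f.
Proof.
move=> mD mf cf foo.
have neg_fin : (\int[mu]_(x in D) f^\- x < +oo)%E.
  apply: (@le_lt_trans _ _ (\int[mu]_(x in D) cst (`|c|%:E) x)%E).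
    apply: ge0_le_integral => //; first exact: measurable_funeneg.
    move=> x Dx; rewrite /= funenegE ge_max lee_fin normr_ge0 andbT.
    rewrite leeNl -EFinN (le_trans _ (cf x Dx))// lee_fin.
    by rewrite lerNl -normrN ler_norm.
  rewrite integral_cst// lte_mul_pinfty ?lee_fin//.
  by rewrite ltey_eq fin_num_measure.
apply/integrableP; split => //.
rewrite (eq_integral (f^\+ \+ f^\-)%E); last first.
  by move=> x _; rewrite -[RHS]/((f^\+ \+ f^\-)%E x) -fune_abse.
rewrite ge0_integralD//; try exact: measurable_funepos;
  try exact: measurable_funeneg.
rewrite lte_add_pinfty//.
rewrite [X in (X < _)%E]integralE in foo.
have fin_neg : (\int[mu]_(x in D) f^\- x)%E \is a fin_num.
  by rewrite ge0_fin_numE// integral_ge0.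
by move: foo; rewrite lteBlDr//; move/lt_le_trans; apply; exact: leey.
Qed.

(** Tonelli's theorem applied to the positive and the negative parts, so that
    no integrability in y is required. *)
Lemma measurable_integral_section d1 d2 (T1 : measurableType d1)
    (T2 : measurableType d2) (R : realType)
    (mu : {sigma_finite_measure set T2 -> \bar R}) (D : set T2)
    (f : T1 * T2 -> \bar R) :
  measurable D -> measurable_fun setT f ->
  measurable_fun setT (fun x => \int[mu]_(y in D) f (x, y))%E.
Proof.
move=> mD mf.
have mTD : measurable ([set: T1] `*` D) by exact: measurableX.
pose g := f \_ ([set: T1] `*` D).
have mg : measurable_fun setT g.
  by apply/(measurable_restrictT _ mTD); apply: measurable_funTS.
under [X in measurable_fun _ X]eq_fun => x do
  rewrite integral_mkcond integralE.
have gE x y : ((fun y => f (x, y)) \_ D) y = g (x, y).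
  rewrite /g /patch; congr (if _ then _ else _).
  by apply/idP/idP; rewrite !inE/= => //; case.
rewrite (_ : (fun x => _) = fubini_F mu g^\+ \- fubini_F mu g^\-)%E.
  by apply: emeasurable_funB; apply: measurable_fun_fubini_tonelli_F => //;
    [exact: measurable_funepos|exact: measurable_funeneg].
apply/funext => x; congr (_ - _)%E; apply: eq_integral => y _;
  by rewrite ?funeposE ?funenegE gE.
Qed.

(** * The logarithmic kernel on the circle *)

Lemma le_cmodB (R : realType) (x y w : R[i]) :
  cmod (x - y) <= cmod (x - w) + cmod (y - w).
Proof.
rewrite -lecR rmorphD /=; apply: le_trans (ler_distD w x y) _.
by rewrite lerD2l distrC.
Qed.

Lemma log_kernel_ge (R : realType) (x y : R[i]) (s : R) :
  cmod (x - y) <= s -> ((- ln s)%:E <= log_kernel x y)%E.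
Proof.
move=> xys; rewrite log_kernelE; case: ifPn => [_|xy0]; first exact: leey.
have c0 : 0 < cmod (x - y).
  by rewrite lt_neqAle eq_sym xy0; case: (x - y) => a b; exact: sqrtr_ge0.
by rewrite lee_fin lerN2 ler_ln ?posrE// (lt_le_trans c0).
Qed.

Lemma log_kernel_circle_ge (R : realType) (x y : R[i]) :
  unit_circle x -> unit_circle y -> ((- ln 2)%:E <= log_kernel x y)%E.
Proof.
rewrite /unit_circle/= => x1 y1; apply: log_kernel_ge.
by rewrite (le_trans (le_cmodB x y 0))// !subr0 x1 y1.
Qed.

Lemma measurable_cball (R : realType) (w : R[i]) (r : R) :
  measurable ([set x : R[i] | cmod (x - w) < r] : set (borelC R)).
Proof.
have := @measurable_cmod_sub _ (borelC R) R id (cst w)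
  (@measurable_id _ _ _) (@measurable_cst _ _ _ _ _ _).
move=> /(_ measurableT `]-oo, r[%classic (measurable_itv _)).
rewrite setTI; congr measurable.
Qed.

Lemma measurable_circle (R : realType) :
  measurable (@unit_circle R : set (borelC R)).
Proof.
have := @measurable_cmod_sub _ (borelC R) R id (cst 0)
  (@measurable_id _ _ _) (@measurable_cst _ _ _ _ _ _).
move=> /(_ measurableT [set 1] (measurable_set1 _)).
rewrite setTI; congr measurable.
by apply/seteqP; split => x /=; rewrite subr0.
Qed.

(** * Potentials and measures of finite energy *)

Definition log_potential (R : realType) (mu : probability (borelC R) R)
    (x : R[i]) : \bar R :=
  (\int[mu]_(y in @unit_circle R) log_kernel x (y : R[i]))%E.

Lemma measurable_log_potential (R : realType) (mu : probability (borelC R) R) :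
  measurable_fun setT (log_potential mu : borelC R -> \bar R).
Proof.
exact: (measurable_integral_section mu (@measurable_circle R)
  (@measurable_log_kernel R)).
Qed.

(** A point of the disc is at distance less than 2 r from all the others, so
    there the kernel is at least - ln (2 r); elsewhere on the circle it is at
    least - ln 2. Integrate (- ln r) * 1_B - ln 2. *)
Lemma log_potential_ge_ball (R : realType) (mu : probability (borelC R) R)
    (w x : R[i]) (r : R) :
  0 < r -> unit_circle x -> cmod (x - w) < r ->
  ((- ln r)%:E * mu ([set y : borelC R | cmod ((y : R[i]) - w) < r]%R `&`
     @unit_circle R) - (ln 2)%:E <= log_potential mu x)%E.
Proof.
move=> r0 Cx xw; set B := [set y : borelC R | cmod ((y : R[i]) - w) < r].
have mC := @measurable_circle R.
have mB : measurable B by exact: measurable_cball.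
have ln2 : 0 <= ln (2 : R) by rewrite ln_ge0// ler1n.
have iB : mu.-integrable (@unit_circle R) (fun y => (\1_B y : R)%:E).
  by apply: integrableS (integrable_indic _ mB).
pose h (y : borelC R) : \bar R :=
  ((- ln r)%:E * (\1_B y : R)%:E - (cst (ln 2)%:E : borelC R -> \bar R) y)%E.
have intL : mu.-integrable (@unit_circle R)
    (fun y => ((- ln r)%:E * (\1_B y : R)%:E)%E).
  exact: integrableZl.
have int2 : mu.-integrable (@unit_circle R)
    (cst (ln 2)%:E : borelC R -> \bar R).
  exact: finite_measure_integrable_cst.
apply: (@le_trans _ _ (\int[mu]_(y in @unit_circle R) h y)%E).
  rewrite /h integralB// integralZl// integral_indic// leeB//.
  rewrite integral_cst// -[leRHS]mule1 lee_wpmul2l ?lee_fin//.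
  exact: probability_le1.
apply: le_integral_measurable => //.
- by have /integrableP[] := integrableB mC intL int2.
- apply: measurable_funTS.
  have mx : measurable_fun setT (fun y : borelC R => (x : borelC R, y)).
    by apply: measurable_fun_pair => //; exact: measurable_cst.
  exact: (measurableT_comp (@measurable_log_kernel R) mx).
move=> y Cy; rewrite /h indicE; case: (boolP (y \in B)) => [|_]; last first.
  by rewrite mule0 add0e; exact: log_kernel_circle_ge.
rewrite inE /B/= => yw; rewrite mule1 -EFinB.
rewrite -opprD addrC -lnM ?posrE//; apply: log_kernel_ge.
rewrite (le_trans (le_cmodB x y w))// mulr_natl mulr2n.
by rewrite lerD// ltW.
Qed.

Lemma log_potential_ge (R : realType) (mu : probability (borelC R) R)
    (x : R[i]) :
  unit_circle x -> ((- ln 2)%:E <= log_potential mu x)%E.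
Proof.
move=> Cx.
(* For r = 1 the term - ln r of the disc estimate vanishes. *)
have := @log_potential_ge_ball R mu x x 1 ltr01 Cx.
rewrite subrr ln1 oppr0 mul0e add0e; apply.
by rewrite ComplexField.Normc.normc0.
Qed.

(** Borel-Cantelli is applied to the traces of the discs on each sublevel set
    of the potential: the trace is empty or the disc contains a point of small
    potential, which bounds the mass of the whole disc linearly. *)
Lemma finite_energy_limsup_negligible (R : realType)
    (mu : probability (borelC R) R) (w : nat -> R[i]) (r : nat -> R) :
  (log_energy mu < +oo)%E -> (forall n, 0 < r n < 1) ->
  (\sum_(0 <= n <oo) ((- ln (r n))^-1)%:E < +oo)%E ->
  mu.-negligible (@unit_circle R `&`
    lim_sup_set (fun n => [set x : borelC R | cmod ((x : R[i]) - w n) < r n])).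
Proof.
move=> energy_fin r01 sum_fin.
set B := fun n => [set x : borelC R | _].
have mC := @measurable_circle R.
have mB n : measurable (B n) by exact: measurable_cball.
have mV := measurable_log_potential mu.
have intV : mu.-integrable (@unit_circle R) (log_potential mu).
  apply: integrable_bounded_below energy_fin => //.
    exact: measurable_funTS.
  by move=> x; exact: log_potential_ge.
pose A (m : nat) : set (borelC R) := @unit_circle R `&`
  [set x : borelC R | log_potential mu x <= m%:R%:E]%E.
have mA m : measurable (A m).
  exact: (emeasurable_fun_infty_c mC (measurable_funTS mV)).
have null m : mu (lim_sup_set (fun n => A m `&` B n)) = 0.
  have ln2 : 0 <= ln (2 : R) by rewrite ln_ge0// ler1n.
  apply: lim_sup_set_cvg0 => [n|]; first exact: measurableI.
  have L0 n : 0 < - ln (r n) by rewrite oppr_gt0 ln_lt0.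
  apply: (@le_lt_trans _ _ (\sum_(0 <= n <oo)
      ((m%:R + ln 2)%:E * ((- ln (r n))^-1)%:E))%E).
    apply: lee_nneseries => // n _.
    have [[x [[Cx Vx] Bx]]|AB0] := pselect (A m `&` B n !=set0); last first.
      move/set0P/negP/negPn/eqP: AB0 => ->; rewrite measure0 mule_ge0// lee_fin.
        by rewrite addr_ge0.
      by rewrite invr_ge0 ltW.
    have /andP[r0 _] := r01 n.
    have := le_trans (log_potential_ge_ball mu r0 Cx Bx) Vx.
    rewrite leeBlDr// -EFinD => le_mass.
    rewrite lee_pdivlMr// muleC; apply: le_trans le_mass.
    rewrite lee_wpmul2l ?lee_fin ?(ltW (L0 n))//.
    apply: le_measure; rewrite ?inE; first exact: measurableI.
      exact: measurableI (mB n) mC.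
    by move=> y [[Cy _] By].
  rewrite nneseriesZl//.
    by rewrite lte_mul_pinfty// lee_fin addr_ge0.
  by move=> n _; rewrite lee_fin invr_ge0 ltW.
apply: negligibleS (negligibleU
  (_ : mu.-negligible
    (~` [set x | unit_circle x -> log_potential mu x \is a fin_num]))
  (negligible_bigcup (F := fun m => lim_sup_set (fun n => A m `&` B n)) _)).
- move=> x [Cx Bx].
  have [Vfin|] := boolP (log_potential mu x \is a fin_num); last first.
    by move=> /negP Vx; left => /= /(_ Cx).
  right; exists (Num.bound `|fine (log_potential mu x)|) => //.
  move=> n _; have [k nk Bk] := Bx n I; exists k => //; split => //; split => //=.
  rewrite -[leLHS]fineK// lee_fin (le_trans (ler_norm _))//.
  by rewrite ltW// archi_boundP.
- exact: (integrable_ae mC intV).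
- move=> m; exists (lim_sup_set (fun n => A m `&` B n)); split => //;
    last exact: null.
  apply: bigcap_measurable => // k _; apply: bigcup_measurable => j _.
  exact: measurableI.
Qed.

(** * The Poisson sum off the discs *)

Lemma cmod_gt0 (R : realType) (w : R[i]) : w != 0 -> 0 < cmod w.
Proof.
move=> w0; rewrite lt_neqAle; apply/andP; split.
  by apply: contra_neq w0 => /esym; exact: ComplexField.Normc.eq0_normc.
by case: (w) => a b; exact: sqrtr_ge0.
Qed.

Lemma ln_disk_lt0 (R : realType) (w : R[i]) :
  w != 0 -> unit_disk w -> ln (1 - cmod w) < 0.
Proof.
rewrite /unit_disk/= => w0 w1.
by rewrite ln_lt0// subr_gt0 w1/= ltrBlDr ltrDl cmod_gt0.
Qed.

(** With l = - ln (1 - |w|), the condition on x says that |x - w|^2 is at least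
    exp (- l / 2), while 1 - |w|^2 <= 2 exp (- l). The quotient is at most
    2 exp (- l / 2), and this is at most 4 / l as l / 2 < exp (l / 2). *)
Lemma poisson_le (R : realType) (w x : R[i]) :
  w != 0 -> unit_disk w ->
  expR (ln (1 - cmod w) / 4) <= cmod (x - w) ->
  (1 - cmod w ^+ 2) / cmod (x - w) ^+ 2 <= 4 / `|ln (1 - cmod w)|.
Proof.
move=> w0; rewrite /unit_disk/= => w1 xw.
have cw0 := cmod_gt0 w0.
set d := 1 - cmod w in xw *.
have d0 : 0 < d by rewrite subr_gt0.
have lnd : ln d < 0 := ln_disk_lt0 w0 w1.
rewrite ltr0_norm//; set l := - ln d.
have l0 : 0 < l by rewrite oppr_gt0.
have xw2 : expR (- (l / 2)) <= cmod (x - w) ^+ 2.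
  rewrite (_ : expR _ = expR (ln d / 4) ^+ 2); last first.
    by rewrite -expRM_natl; congr expR; rewrite /l; field.
  by rewrite ler_sqr ?nnegrE ?expR_ge0// (le_trans _ xw)// expR_ge0.
have dE : d = expR (- l) by rewrite opprK lnK.
have d2 : 1 - cmod w ^+ 2 <= 2 * expR (- l) by rewrite -dE /d; nra.
have e0 := expR_gt0 (- (l / 2)).
rewrite ler_pdivrMr ?(lt_le_trans e0)//.
apply: (le_trans d2).
apply: (@le_trans _ _ (4 / l * expR (- (l / 2)))); last first.
  by rewrite ler_wpM2l// divr_ge0// ltW.
have -> : expR (- l) = expR (- (l / 2)) * expR (- (l / 2)).
  by rewrite -expRD; congr expR; field.
rewrite mulrA ler_wpM2r ?(ltW e0)// expRN.
rewrite ler_pdivrMr ?expR_gt0// mulrAC ler_pdivlMr//.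
have := expR_ge1Dx (l / 2); lra.
Qed.

Lemma exceptional_set_sub_limsup (R : realType) (z : nat -> R[i]) :
  (forall n, unit_disk (z n)) -> (forall n, z n != 0) -> shapiro_shields z ->
  exceptional_set z `<=` @unit_circle R `&`
    lim_sup_set (fun n => [set x : R[i] |
      cmod (x - z n) < expR (ln (1 - cmod (z n)) / 4)]).
Proof.
move=> zD z0 ss x [Cx xoo]; split => //.
apply: contrapT => /existsNP[N /not_implyP[_ xN]].
suff : (\sum_(0 <= n <oo)
  ((1 - cmod (z n) ^+ 2) / cmod (x - z n) ^+ 2)%:E < +oo)%E by rewrite xoo.
have P0 n : 0 <= (1 - cmod (z n) ^+ 2) / cmod (x - z n) ^+ 2.
  rewrite divr_ge0 ?sqr_ge0// subr_ge0 expr_le1//; first exact/ltW/zD.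
  by case: (z n) => a b; exact: sqrtr_ge0.
(* From N on, x avoids the discs; the first N terms are real numbers. *)
rewrite (nneseries_split _ N); last by move=> k _; rewrite lee_fin.
rewrite add0n lte_add_pinfty//; first by rewrite sumEFin ltry.
apply: (@le_lt_trans _ _ (\sum_(N <= n <oo)
    (4%:E * (`|ln (1 - cmod (z n))|)%:E^-1))%E).
  (* Move the range N <= n into the condition, where the estimate of the terms
     can use it. *)
  rewrite 2!(@eseries_cond _ _ (fun=> true)).
  apply: lee_nneseries => n; first by move=> _ _; rewrite lee_fin.
  rewrite andTb => Nn.
  have ln0 : `|ln (1 - cmod (z n))| != 0.
    by rewrite normr_eq0 lt_eqF// ln_disk_lt0.
  rewrite inver (negbTE ln0) -EFinM lee_fin; apply: poisson_le => //.
  by rewrite leNgt; apply/negP => xB; apply: xN; exists n.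
rewrite nneseriesZl; last first.
  by move=> i _; rewrite inve_ge0 lee_fin.
rewrite lte_mul_pinfty//; apply: le_lt_trans ss.
rewrite [leRHS](nneseries_split _ N); last first.
  by move=> k _; rewrite inve_ge0 lee_fin.
rewrite add0n leeDr// sume_ge0// => i _; by rewrite inve_ge0 lee_fin.
Qed.

(** * Capacity of the exceptional set *)

Theorem proposition4p1 (R : realType) (z : nat -> R[i])
    (z_disk : forall n : nat, unit_disk (z n))
    (z_ss : shapiro_shields z) :
  log_capacity (exceptional_set z) = 0%E.
Proof.
have inv0 n : (0 <= (`|ln (1 - cmod (z n))|)%:E^-1)%E.
  by rewrite inve_ge0 lee_fin.
(* A zero z n would make the Shapiro-Shields sum infinite. *)
have z0 n : z n != 0.
  apply/eqP => zn0; move: z_ss; rewrite /shapiro_shields.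
  rewrite (@nneseriesD1 _ _ n)// zn0 ComplexField.Normc.normc0 subr0 ln1.
  rewrite normr0 inve0 addye// gt_eqF// (lt_le_trans (@ltNy0 R))//.
  by rewrite nneseries_ge0.
suff energy_oo mu : compactly_supported_in (exceptional_set z) mu ->
    log_energy mu = +oo%E.
  rewrite /log_capacity (_ : ereal_inf _ = +oo%E) ?invey//.
  by apply/ereal_inf_pinfty => _ [mu /energy_oo -> <-].
move=> [K [cK KE muK]]; apply/eqP; rewrite -leye_eq leNgt; apply/negP => fin.
have lnz n := ln_disk_lt0 (z0 n) (z_disk n).
pose r n : R := expR (ln (1 - cmod (z n)) / 4).
have r01 n : 0 < r n < 1.
  by rewrite expR_gt0/= expR_lt1 pmulr_llt0// lnz.
have sum_fin : (\sum_(0 <= n <oo) ((- ln (r n))^-1)%:E < +oo)%E.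
  rewrite (eq_eseriesr (g := fun n =>
      (4%:E * (`|ln (1 - cmod (z n))|)%:E^-1)%E)) => [|n _].
    by rewrite nneseriesZl// lte_mul_pinfty.
  rewrite inver normr_eq0 lt_eqF// -EFinM ltr0_norm// /r expRK.
  by rewrite -mulNr invf_div.
have [N [mN N0 subN]] := finite_energy_limsup_negligible z fin r01 sum_fin.
have KN : K `<=` N.
  by move=> x /KE /(exceptional_set_sub_limsup z_disk z0 z_ss); exact: subN.
have : (mu K <= mu N)%E.
  by apply: le_measure => //; rewrite inE//; exact: compact_borelC_measurable.
by rewrite N0 [X in (X <= _)%E]muK lee_fin ler10.
Qed.
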